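(* Let $p$ be a prime, let $\epsilon>0$, and let $u\ge 0$ be an integer. For each $n$ let $M=M^{(n)}\in M_{n\times(n+u)}(\mathbb{Z}/p\mathbb{Z})$ be an $\epsilon$-balanced random matrix. Then for every non-negative integer $k$, $$\lim_{n\to\infty}\mathbb{P}(\operatorname{rank}(M)=n-k)=p^{-k(k+u)}\prod_{i=1}^{k}(1-p^{-i})^{-1}\prod_{i=1}^{k+u}(1-p^{-i})^{-1}\prod_{i\ge 1}(1-p^{-i}).$$
   Context: A random matrix over $\mathbb{Z}/p\mathbb{Z}$ is $\epsilon$-balanced if its entries are independent and every entry $y$ satisfies $\mathbb{P}(y=r)\le 1-\epsilon$ for every $r\in\mathbb{Z}/p\mathbb{Z}$. The entries need not be identically distributed and their distributions may vary with $n$; $\epsilon$ and $u$ do not depend on $n$. *)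

(* Defs.v *)
From HB Require Import structures.
From mathcomp Require Import all_boot all_order all_algebra.
From mathcomp Require Import all_classical all_reals all_analysis.

Set Implicit Arguments.
Unset Strict Implicit.
Unset Printing Implicit Defensive.

Import Order.TTheory GRing.Theory Num.Theory.
Import numFieldNormedType.Exports.

Local Open Scope classical_set_scope.
Local Open Scope ring_scope.

Section RandomMatrices.
Context (d : measure_display) (T : measurableType d) (R : realType).
Variable P : probability T R.

(* Measurability of X for the discrete sigma-algebra on S. *)
Definition discrete_rv (S : Type) (X : T -> S) : Prop :=
  forall B : set S, measurable (X @^-1` B).

Definition mutually_independent (I : finType) (S : Type) (X : I -> T -> S) :
    Prop :=
  forall (J : {set I}) (B : I -> set S),
    P (\bigcap_(i in [set` J]) (X i @^-1` B i)) =
    (\prod_(i in J) P (X i @^-1` B i))%E.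

(* In this and the next definition p is meant to be prime, so that 'F_p is
   Z/pZ. *)
Definition random_matrix (p m n : nat) (M : T -> 'M['F_p]_(m, n)) : Prop :=
  forall i j, discrete_rv (fun w => M w i j).

Definition eps_balanced (eps : R) (p m n : nat) (M : T -> 'M['F_p]_(m, n)) :
    Prop :=
  [/\ random_matrix M,
      mutually_independent
        (fun (ij : 'I_m * 'I_n) (w : T) => M w ij.1 ij.2)
    & forall (i : 'I_m) (j : 'I_n) (r : 'F_p),
        (P [set w | M w i j = r] <= (1 - eps)%:E)%E].

End RandomMatrices.

Definition infinite_prod (R : realType) (a : nat -> R) : R :=
  limn (fun N : nat => \prod_(1 <= i < N.+1) a i).

(* Main.v *)
(* The moment method over F_p.  Let K be the dimension of the left kernel of M.
   Counting j-tuples of independent vectors in that kernel gives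
     E[(p^K - 1)(p^K - p)...(p^K - p^(j-1))] = sum over V of P(V M = 0),
   where V ranges over the j x n matrices of rank j, and P(V M = 0) factors over
   the columns of M.  By Fourier inversion P(V c = 0), for one column c, differs
   from p^-j by at most p^-j times the sum over a <> 0 of rho^wt(a V), with
   rho < 1 depending on p and eps only.  If all the weights wt(a V) are at least
   linear in n, the product over the columns is p^(-j (n + u)) (1 + o(1)).
   Otherwise some maximal s-dimensional space of combinations of the rows of V
   is supported on a small set of coordinates: this costs a factor p^(-s n) in the
   number of such V up to a small exponential (Chernoff), gains a factor p^s per
   column in P(V c = 0), and leaves a factor < 1 per column to spare.  So the
   moments tend to p^(-j u).

   The moments determine the law of K: interpolating the indicator of K = k at
   the nodes p^0, ..., p^(k + m) (Lagrange) gives functions of p^K lying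
   alternately above and below it, so P(K = k) is squeezed between finite
   combinations of moments.  Their limits are the partial sums of Euler's series
     sum_i (-1)^i y^i / ((p - 1)...(p^i - 1)) = prod_{i >= 1} (1 - y p^-i)
   at y = p^-(k + u). *)

Require Import Defs.
From mathcomp Require Import all_boot all_order all_algebra.
From mathcomp Require Import all_classical all_reals all_analysis.
From mathcomp Require Import complex mxabelem.
From mathcomp Require Import ring lra zify.

Set Implicit Arguments.
Unset Strict Implicit.
Unset Printing Implicit Defensive.

Import Order.TTheory GRing.Theory Num.Theory.
Import numFieldNormedType.Exports.

Local Open Scope classical_set_scope.
Local Open Scope ring_scope.

(** * Characters of F_p *)

Lemma big_distr_cols (R : comPzSemiRingType) (F : finNzRingType) (m n : nat)
    (g : 'I_n -> 'cV[F]_m -> R) :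
  \sum_(A : 'M[F]_(m, n)) \prod_c g c (col c A) = \prod_c \sum_v g c v.
Proof.
rewrite bigA_distr_bigA /=.
pose h (f : {ffun 'I_n -> 'cV[F]_m}) : 'M[F]_(m, n) := \matrix_(i, c) f c i 0.
rewrite (reindex h) /=; last first.
  exists (fun A : 'M[F]_(m, n) => [ffun c => col c A]) => [f _|A _].
    by apply/ffunP => c; rewrite ffunE; apply/colP => i; rewrite !mxE.
  by apply/matrixP => i c; rewrite !mxE ffunE !mxE.
apply: eq_bigr => f _; apply: eq_bigr => c _; congr g.
by apply/colP => i; rewrite !mxE.
Qed.

Lemma big_distr_col (R : comPzSemiRingType) (F : finNzRingType) (n : nat)
    (g : 'I_n -> F -> R) :
  \sum_(v : 'cV[F]_n) \prod_i g i (v i 0) = \prod_i \sum_x g i x.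
Proof.
rewrite bigA_distr_bigA /=.
pose h (f : {ffun 'I_n -> F}) : 'cV[F]_n := \col_i f i.
rewrite (reindex h) /=; last first.
  exists (fun v : 'cV[F]_n => [ffun i => v i 0]) => [f _|v _].
    by apply/ffunP => i; rewrite ffunE !mxE.
  by apply/colP => i; rewrite !mxE ffunE.
by apply: eq_bigr => f _; apply: eq_bigr => i _; rewrite mxE.
Qed.

(** A root of 1 + X + ... + X^(p-1) has order dividing the prime p; order 1 is excluded because p is
    nonzero in characteristic 0. *)
Lemma prim_root_prime_exists (C : numClosedFieldType) (p : nat) :
  prime p -> exists z : C, p.-primitive_root z.
Proof.
move=> p_pr; have p1 := prime_gt1 p_pr; have p0 := prime_gt0 p_pr.
have /closed_rootP[z rz] : size (\poly_(i < p) (1 : C)) != 1.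
  by rewrite size_poly_eq ?oner_eq0 // gtn_eqF.
have sz : \sum_(i < p) z ^+ i = 0.
  have := eqP rz; rewrite horner_poly.
  by under eq_bigr => i _ do rewrite mul1r.
have zp : z ^+ p = 1 by apply/eqP; rewrite -subr_eq0 subrX1 sz mulr0.
have [m mz mp] := prim_order_exists p0 zp; exists z.
suff m1 : m != 1%N by rewrite -(prime_nt_dvdP p_pr m1 mp).
apply/eqP => m1; move: mz sz; rewrite m1 => /prim_expr_order; rewrite expr1 => ->.
under eq_bigr => i _ do rewrite expr1n.
by rewrite sumr_const card_ord => /eqP; rewrite pnatr_eq0 gtn_eqF.
Qed.

Section Characters.
Variables (C : numClosedFieldType) (p : nat) (p_pr : prime p) (z : C).
Hypothesis z_prim : p.-primitive_root z.

Definition fp_char (x : 'F_p) : C := z ^+ x.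

Lemma fp_char0 : fp_char 0 = 1. Proof. by []. Qed.

Lemma fp_charD x y : fp_char (x + y) = fp_char x * fp_char y.
Proof.
rewrite -exprD -(expr_mod _ (prim_expr_order z_prim)); congr (_ ^+ _).
exact: (congr1 (modn (x + y)) (Fp_cast p_pr)).
Qed.

Lemma fp_char_sum (I : finType) (f : I -> 'F_p) :
  fp_char (\sum_i f i) = \prod_i fp_char (f i).
Proof. exact: (big_morph fp_char fp_charD fp_char0). Qed.

Lemma fp_char_eq1 x : (fp_char x == 1) = (x == 0).
Proof.
rewrite /fp_char -(prim_order_dvd z_prim) /dvdn -val_eqE /= modn_small //.
by have := ltn_ord x; rewrite [X in (_ < X)%N -> _]Fp_cast.
Qed.

Lemma norm_fp_char x : `|fp_char x| = 1.
Proof.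
rewrite normrX; suff -> : `|z| = 1 by rewrite expr1n.
apply/eqP; rewrite -(@pexpr_eq1 _ _ p) ?prime_gt0 //.
by rewrite -normrX prim_expr_order // normr1.
Qed.

(** If [y i 0 != 0], translating [a] by the i-th unit vector multiplies the sum by
    [fp_char (y i 0) != 1], so the sum vanishes. *)
Lemma fp_char_orthogonality (j : nat) (y : 'cV['F_p]_j) :
  \sum_(a : 'rV['F_p]_j) fp_char ((a *m y) 0 0) = (y == 0)%:R * p%:R ^+ j.
Proof.
have [->|y0] := eqVneq y 0.
  rewrite mul1r (eq_bigr (fun _ => 1)) => [|a _]; last by rewrite mulmx0 mxE.
  by rewrite sumr_const card_mx card_Fp // mul1n natrX.
rewrite mul0r; have [i yi] : exists i, y i 0 != 0.
  apply/existsP; apply: contraNT y0 => /existsPn y0.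
  by apply/eqP/colP => i; rewrite mxE; apply/eqP; rewrite -[_ == _]negbK.
set S := \sum_a _; have : S * (fp_char (y i 0) - 1) = 0.
  rewrite mulrBr mulr1 /S [X in _ - X](reindex_inj (addIr (delta_mx 0 i))).
  apply/eqP; rewrite subr_eq0 mulr_suml; apply/eqP/eq_bigr => a _.
  by rewrite mulmxDl -rowE !mxE fp_charD.
by move/eqP; rewrite mulf_eq0 subr_eq0 fp_char_eq1 (negPf yi) orbF => /eqP.
Qed.

(* Fourier inversion: the left side is p^j times the mass of the kernel of V
   under the product weight. *)
Lemma kernel_mass_fourier (n j : nat) (nu : 'I_n -> 'F_p -> C)
    (V : 'M['F_p]_(j, n)) :
  p%:R ^+ j * (\sum_(c : 'cV_n | V *m c == 0) \prod_i nu i (c i 0)) =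
  \sum_(a : 'rV_j) \prod_i \sum_x fp_char ((a *m V) 0 i * x) * nu i x.
Proof.
under [RHS]eq_bigr => a _ do
  rewrite -(big_distr_col (fun i x => fp_char ((a *m V) 0 i * x) * nu i x)).
rewrite exchange_big /= mulr_sumr big_mkcond; apply: eq_bigr => c _.
under [RHS]eq_bigr => a _.
  rewrite big_split /= -fp_char_sum.
  have -> : \sum_i (a *m V) 0 i * c i 0 = (a *m (V *m c)) 0 0.
    by rewrite mulmxA [RHS]mxE.
  over.
rewrite -mulr_suml fp_char_orthogonality.
by case: eqP; rewrite ?mul1r ?mul0r.
Qed.

End Characters.

Section CharacterContraction.
Variables (R : realType) (p : nat) (p_pr : prime p) (z : R[i]).
Hypothesis z_prim : p.-primitive_root z.
Local Notation chi := (@fp_char _ p z).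
Local Notation toC := (real_complex R).

(** Equality in the triangle inequality would force [chi x = 1], which a nonzero [x] excludes. *)
Lemma norm_add1_fp_char_lt2 (x : 'F_p) : x != 0 -> `|1 + chi x| < 2.
Proof.
move=> x0; rewrite lt_neqAle; apply/andP; split; last first.
  by rewrite (le_trans (ler_normD _ _)) // normr1 norm_fp_char.
apply: contra x0 => /eqP e.
have : `|1 + chi x| = `|1| + `|chi x| by rewrite e normr1 norm_fp_char.
move=> /normCDeq[t _ []]; rewrite normr1 norm_fp_char // !mul1r => <- e1.
by rewrite -(fp_char_eq1 p_pr z_prim) e1.
Qed.

Lemma norm_add1_fp_char_bound :
  exists2 theta : R, theta < 2 &
    forall x : 'F_p, x != 0 -> `|1 + chi x| <= toC theta.
Proof.
pose r (x : 'F_p) : R := complex.Re `|1 + chi x|.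
have rE x : toC (r x) = `|1 + chi x| by rewrite /r RRe_real // normr_real.
exists (\big[Num.max/0]_(x | x != 0) r x).
  apply/bigmax_ltP; split=> // x x0.
  by rewrite -ltcR rE (_ : 2%:C%C = 2) ?norm_add1_fp_char_lt2 // rmorph_nat.
by move=> x x0; rewrite -rE lecR; apply: le_bigmax_cond.
Qed.

(* An eps-balanced law has two atoms of mass at least eps / p, and these two
   partially cancel in the character sum. *)
Lemma balanced_char_contraction (eps : R) : 0 < eps ->
  exists2 rho : R, 0 < rho < 1 &
    forall nu : 'F_p -> R, (forall x, 0 <= nu x) -> \sum_x nu x = 1 ->
      (forall x, nu x <= 1 - eps) ->
      forall b, b != 0 -> `|\sum_x chi (b * x) * toC (nu x)| <= toC rho.
Proof.
move=> eps0; have [theta theta2 thetaP] := norm_add1_fp_char_bound.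
have p0 : 0 < p%:R :> R by rewrite ltr0n prime_gt0.
pose eta := eps / p%:R.
have eta0 : 0 < eta by rewrite divr_gt0.
(* The entry 2^-1 only keeps the constant positive; the contraction comes from the second entry. *)
exists (Num.max (2^-1) (1 - eta * (2 - theta))).
  rewrite lt_max invr_gt0 ltr0n /= gt_max; apply/andP; split; first by lra.
  by rewrite gtrBl mulr_gt0 // subr_gt0.
move=> nu nu0 nu1 nule b b0.
(* Pigeonhole: a set of mass at least [s] contains an atom of mass at least s / p. *)
have pig (A : {pred 'F_p}) y s : y \in A -> s <= \sum_(x in A) nu x ->
    exists2 x, x \in A & s / p%:R <= nu x.
  move=> yA sA; case: (@arg_maxP _ _ _ y (mem A) nu yA) => x xA xmax.
  exists x => //; rewrite ler_pdivrMr // (le_trans sA) //.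
  apply: (@le_trans _ _ (\sum_(i in A) nu x)); first by apply: ler_sum => i /xmax.
  rewrite sumr_const mulr_natr; apply: ler_wpMn2l => //.
  by rewrite -[X in (_ <= X)%N](card_Fp p_pr) max_card.
have eps1 : eps <= 1 by have := nu0 0; have := nule 0; lra.
have [r0 _ r0P] : exists2 x, x \in 'F_p & 1 / p%:R <= nu x.
  by apply: (pig _ 0) => //; rewrite -nu1.
(* Since [nu r0 <= 1 - eps], mass at least [eps] lies off [r0]. *)
have [r1 r10 r1P] : exists2 x, x \in predC1 r0 & eps / p%:R <= nu x.
  apply: (pig _ (r0 + 1)).
    by rewrite !inE -subr_eq0 addrC addKr oner_eq0.
  by move: nu1 (nule r0); rewrite (bigD1 r0) //=; lra.
rewrite inE /= in r10.
(* Mass [eta] is removed from each of the two atoms; the remainder is still nonnegative and is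
   bounded trivially by its total mass. *)
pose nu' x := nu x - eta * ((x == r0)%:R + (x == r1)%:R).
have nu'0 x : 0 <= nu' x.
  rewrite /nu'; case: (eqVneq x r0) => [->|xr0].
    rewrite eq_sym (negPf r10) addr0 mulr1 subr_ge0 (le_trans _ r0P) //.
    by rewrite ler_wpM2r // invr_ge0 ltW.
  case: (eqVneq x r1) => [->|_]; first by rewrite add0r mulr1 subr_ge0.
  by rewrite addr0 mulr0 subr0.
have delta_sum (f : 'F_p -> R[i]) r : \sum_x f x * toC (x == r)%:R = f r.
  rewrite (bigD1 r) //= eqxx mulr1 big1 ?addr0 // => x /negPf ->.
  by rewrite rmorph0 mulr0.
have nu'1 : \sum_x nu' x = 1 - eta * 2.
  have one r : \sum_(x : 'F_p) (x == r)%:R = 1 :> R.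
    by rewrite (bigD1 r) //= eqxx big1 ?addr0 // => x /negPf ->.
  by rewrite sumrB nu1 -mulr_sumr big_split /= !one.
have -> : \sum_x chi (b * x) * toC (nu x) =
    \sum_x chi (b * x) * toC (nu' x) + toC eta * (chi (b * r0) + chi (b * r1)).
  rewrite -(delta_sum (fun x => chi (b * x)) r0).
  rewrite -(delta_sum (fun x => chi (b * x)) r1).
  rewrite -big_split /= mulr_sumr -big_split /=; apply: eq_bigr => x _.
  by rewrite /nu' rmorphB rmorphM rmorphD /=; ring.
have br : b * (r1 - r0) != 0 by rewrite mulf_neq0 // subr_eq0.
apply: (@le_trans _ _ (toC (1 - eta * (2 - theta)))); last first.
  by rewrite lecR le_max lexx orbT.
apply: (le_trans (ler_normD _ _)).
have -> : toC (1 - eta * (2 - theta)) =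
    toC (\sum_x nu' x) + toC eta * toC theta.
  by rewrite nu'1 -rmorphM -rmorphD /=; congr toC; ring.
apply: lerD.
  apply: (le_trans (ler_norm_sum _ _ _)); rewrite rmorph_sum ler_sum //= => x _.
  by rewrite normrM norm_fp_char // mul1r ger0_norm // ler0c.
(* A common phase factors out of the two atoms and leaves [1 + chi (b * (r1 - r0))], of modulus at
   most [theta]. *)
have -> : chi (b * r1) = chi (b * r0) * chi (b * (r1 - r0)).
  by rewrite -fp_charD // -mulrDr addrC subrK.
rewrite -[X in X + _]mulr1 -mulrDr !normrM norm_fp_char // mul1r.
rewrite ger0_norm ?ler0c; last exact: ltW.
by rewrite ler_wpM2l ?thetaP // ler0c ltW.
Qed.

End CharacterContraction.

Definition balanced_law (R : realType) (p : nat) (eps : R) (nu : 'F_p -> R) :=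
  [/\ forall x, 0 <= nu x, \sum_x nu x = 1 & forall x, nu x <= 1 - eps].

Definition hweight (F : nzRingType) (n : nat) (w : 'rV[F]_n) : nat :=
  (\sum_i (w 0%R i != 0%R))%N.

(** When each [nu i] is a law, this is the probability that [V] kills a random column with
    independent entries of these laws. *)
Definition kernel_mass (R : realType) (p n j : nat) (nu : 'I_n -> 'F_p -> R)
    (V : 'M['F_p]_(j, n)) : R :=
  \sum_(c : 'cV_n | V *m c == 0) \prod_i nu i (c i 0).

(** In the Fourier sum the term [a = 0] equals 1. In any other term each nonzero coordinate of
    [a *m V] contributes a factor of modulus at most [rho], and the zero coordinates contribute
    1. *)
Lemma kernel_mass_equidistribution (R : realType) (p : nat) (eps : R) :
  prime p -> 0 < eps ->
  exists2 rho : R, 0 < rho < 1 &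
    forall (n j : nat) (nu : 'I_n -> 'F_p -> R) (V : 'M['F_p]_(j, n)),
      (forall i, balanced_law eps (nu i)) ->
      `|kernel_mass nu V - p%:R ^- j| <=
        p%:R ^- j * \sum_(a : 'rV_j | a != 0) rho ^+ hweight (a *m V).
Proof.
move=> p_pr eps0; have [z z_prim] := prim_root_prime_exists R[i] p_pr.
have [rho rho01 rhoP] := balanced_char_contraction p_pr z_prim eps0.
exists rho => // n j nu V nub.
have p0 : 0 < p%:R ^+ j :> R by rewrite exprn_gt0 // ltr0n prime_gt0.
rewrite -(ler_pM2l p0) mulrA divff ?gt_eqF // mul1r -{1}(gtr0_norm p0) -normrM.
rewrite mulrBr divff ?gt_eqF // -lecR.
have normC_real (x : R) : (`|x|)%:C%C = `|x%:C%C| :> R[i].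
  by rewrite normc_def /= expr0n addr0 sqrtr_sqr.
rewrite normC_real rmorphB rmorphM rmorph1 rmorphXn rmorph_nat /= rmorph_sum /=.
under eq_bigr => c _ do rewrite rmorph_prod.
rewrite (kernel_mass_fourier p_pr z_prim (fun i x => (nu i x)%:C%C)).
rewrite (bigD1 0) //= mul0mx.
rewrite [X in X + _ - 1](_ : _ = 1); last first.
  apply: big1 => i _; have [_ nu1 _] := nub i.
  rewrite -[RHS](rmorph1 (real_complex R)) -nu1 rmorph_sum; apply: eq_bigr => x _.
  by rewrite mxE mul0r fp_char0 mul1r.
rewrite addrC addKr (le_trans (ler_norm_sum _ _ _)) // rmorph_sum /=.
apply: ler_sum => a _; rewrite normr_prod rmorphXn /hweight /=.
have -> : (rho%:C%C : R[i]) ^+ (\sum_i ((a *m V) (0 : 'I_1) i != 0)%R) =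
    \prod_i rho%:C%C ^+ ((a *m V) (0 : 'I_1) i != 0).
  by rewrite (big_morph (fun k => rho%:C%C ^+ k) (exprD _) (expr0 _)).
apply: ler_prod => i _; rewrite normr_ge0 /=; have [nu0 nu1 nule] := nub i.
case: eqVneq => [->|b0]; last exact: rhoP.
rewrite expr0 (eq_bigr (fun x => (nu i x)%:C%C)) => [|x _].
  by rewrite -rmorph_sum nu1 normr1.
by rewrite mul0r fp_char0 mul1r.
Qed.

(** * Counting matrices over a finite field *)

Section Counting.
Variable F : finFieldType.
Local Notation q := #|F|.

Lemma row_free_col_mx1 (n j : nat) (v : 'rV[F]_n) (V : 'M[F]_(j, n)) :
  row_free (col_mx v V) = row_free V && ~~ (v <= V)%MS.
Proof.
have le_sum : (\rank (col_mx v V) <= 1 + \rank V)%N.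
  by rewrite -addsmxE (leq_trans (mxrank_adds_leqif _ _)) // leq_add2r rank_leq_row.
have [vV|vV] := boolP (v <= V)%MS; rewrite ?andbF ?andbT.
  apply: contraTF (rank_leq_row V) => /eqP.
  by rewrite -addsmxE (addsmx_idPr vV) => ->; rewrite ltnn.
apply/idP/idP => /eqP rk; rewrite /row_free.
  by rewrite eqn_leq rank_leq_row -(leq_add2l 1) (leq_trans _ le_sum) // rk.
suff lt_rk : (\rank V < \rank (col_mx v V))%N.
  by rewrite eqn_leq rank_leq_row (leq_ltn_trans _ lt_rk) // rk.
rewrite ltn_neqAle -addsmxE mxrankS ?addsmxSr // andbT.
apply: contra vV => /eqP e; rewrite (submx_trans (addsmxSl v V)) //.
by rewrite -(geq_leqif (mxrank_leqif_sup (addsmxSr v V))) e.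
Qed.

Lemma big_split_row (R : nmodType) (n j : nat) (f : 'M[F]_(1 + j, n) -> R) :
  \sum_V f V = \sum_(V : 'M[F]_(j, n)) \sum_(v : 'rV[F]_n) f (col_mx v V).
Proof.
rewrite pair_big /=.
rewrite (reindex (fun w : 'M[F]_(j, n) * 'rV[F]_n => col_mx w.2 w.1)) //.
exists (fun V => (dsubmx V, usubmx V)) => [[V v] _|V _] /=.
  by rewrite col_mxKd col_mxKu.
by rewrite vsubmxK.
Qed.

Lemma card_submx (n m : nat) (B : 'M[F]_(m, n)) :
  #|[pred v : 'rV[F]_n | (v <= B)%MS]| = (q ^ \rank B)%N.
Proof. by rewrite -card_rowg; apply: eq_card => v; rewrite !inE. Qed.

(** Rows are added one at a time: the next one must lie in the row space of [B] but outside the span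
    of the rows already chosen. *)
Lemma count_row_free_submx (R : comNzRingType) (n m j : nat) (B : 'M[F]_(m, n)) :
  \sum_(V : 'M[F]_(j, n)) ((V <= B)%MS && row_free V)%:R =
  \prod_(i < j) (q%:R ^+ \rank B - q%:R ^+ i) :> R.
Proof.
elim: j => [|j IH].
  rewrite big_ord0 (bigD1 0) //= sub0mx /row_free mxrank0 eqxx.
  by rewrite big1 ?addr0 // => V; rewrite (flatmx0 V) eqxx.
rewrite (@big_split_row _ n j) big_ord_recr -IH /= mulr_suml; apply: eq_bigr => V _.
under eq_bigr => v _ do rewrite row_free_col_mx1 (@col_mx_sub _ 1 j).
have [|/=] := boolP ((V <= B)%MS && row_free V); last first.
  move=> VB; rewrite mul0r big1 // => v _.
  by move: VB; do 2!case: (_ <= _)%MS => //=; case: row_free.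
case/andP => VB Vfree; rewrite mul1r.
have -> : q%:R ^+ \rank B = \sum_(v : 'rV[F]_n | (v <= B)%MS) 1 :> R.
  by rewrite sumr_const card_submx natrX.
have -> : q%:R ^+ j = \sum_(v : 'rV[F]_n | (v <= V)%MS) 1 :> R.
  by rewrite sumr_const card_submx natrX (eqP Vfree).
rewrite [X in _ = X - _]big_mkcond [X in _ = _ - X]big_mkcond -sumrB /=.
apply: eq_bigr => v _; rewrite VB Vfree /= andbT.
have [vV|_] := boolP (v <= V)%MS; last by rewrite andbT subr0; case: ifP.
by rewrite (submx_trans vV VB) subrr.
Qed.

Lemma card_ker_row_free (s j : nat) (U : 'M[F]_(s, j)) : row_free U ->
  #|[pred v : 'cV[F]_j | U *m v == 0]| = (q ^ (j - s))%N.
Proof.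
move=> /eqP rU.
have <- : \rank (kermx U^T) = (j - s)%N by rewrite mxrank_ker mxrank_tr rU.
rewrite -card_submx -(fintype.card_image (can_inj (@trmxK _ _ _))).
apply: eq_card => v; apply/fintype.imageP/idP => [[w wU ->]|vU].
  by rewrite inE; apply/sub_kermxP; rewrite -trmx_mul (eqP wU) trmx0.
exists v^T; last by rewrite trmxK.
rewrite inE; apply/eqP/trmx_inj; rewrite trmx_mul trmxK trmx0.
exact/sub_kermxP.
Qed.

(** This is the number of coordinates at which some vector of the row space of [B] is nonzero. *)
Definition col_support (s n : nat) (B : 'M[F]_(s, n)) : nat :=
  (\sum_c (col c B != 0%R))%N.

(* Chernoff bound: the columns of V are independent, so
   sum_V x^(col_support (U V)) factors over them. *)
Lemma count_small_support (R : realFieldType) (n s j k : nat) (U : 'M[F]_(s, j))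
    (x : R) : row_free U -> 0 < x <= 1 ->
  (\sum_(V : 'M[F]_(j, n)) (col_support (U *m V) <= k)%N%:R) * x ^+ k <=
  (q%:R ^+ (j - s) * (1 + x * q%:R ^+ j)) ^+ n.
Proof.
move=> Ufree /andP[x0 x1].
(* Markov's inequality: as [x <= 1], each counted matrix has [x ^+ k] at most [x] to its support. *)
apply: (@le_trans _ _ (\sum_(V : 'M[F]_(j, n)) x ^+ col_support (U *m V))).
  rewrite mulr_suml; apply: ler_sum => V _.
  case: leqP => [le_k|_]; rewrite ?mul0r ?exprn_ge0 ?(ltW x0) // mul1r.
  by rewrite ler_wiXn2l // ltW.
have -> : \sum_(V : 'M[F]_(j, n)) x ^+ col_support (U *m V) =
    (\sum_(v : 'cV[F]_j) x ^+ (U *m v != 0)) ^+ n.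
  rewrite -[in RHS](card_ord n) -prodr_const -big_distr_cols; apply: eq_bigr => V _.
  rewrite (big_morph (fun k => x ^+ k) (exprD _) (expr0 _)).
  by apply: eq_bigr => c _; rewrite !colE mulmxA.
apply: lerXn2r; rewrite ?nnegrE.
- by apply: sumr_ge0 => v _; rewrite exprn_ge0 // ltW.
- by rewrite mulr_ge0 ?addr_ge0 ?mulr_ge0 ?exprn_ge0 // ltW.
(* The q^(j-s) columns killed by [U] have weight 1; the others, at most q^j in number, have weight
   [x]. *)
rewrite (bigID (fun v => U *m v == 0)) /= mulrDr mulr1; apply: lerD.
  rewrite (eq_bigr (fun=> 1)) => [|v ->]; last by [].
  by rewrite sumr_const card_ker_row_free // natrX.
rewrite (eq_bigr (fun=> x)) => [|v ->]; last by [].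
rewrite sumr_const -[x *+ _]mulr_natr -[X in X <= _]mul1r.
apply: ler_pM => //; first by rewrite mulr_ge0 // ltW.
  by rewrite -natrX ler1n expn_gt0; apply/orP; left; apply/card_gt0P; exists 0.
rewrite ler_wpM2l ?(ltW x0) // -natrX ler_nat.
by rewrite (leq_trans (max_card _)) // card_mx muln1.
Qed.

Lemma hweight_gt0 (n : nat) (w : 'rV[F]_n) : w != 0 -> (0 < hweight w)%N.
Proof.
apply: contraTltn; rewrite leqn0 sum_nat_eq0 => /forallP w0.
rewrite negbK; apply/eqP/rowP => i; rewrite mxE.
by have := w0 i; rewrite /= eqb0 negbK => /eqP.
Qed.

Lemma col_support_row (n : nat) (w : 'rV[F]_n) : col_support w = hweight w.
Proof.
apply: eq_bigr => c _; congr (nat_of_bool (~~ _)).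
apply/eqP/eqP => [/colP/(_ 0)|w0]; first by rewrite !mxE.
by apply/colP => i; rewrite !mxE ord1.
Qed.

Lemma col_support_col_mx (s n : nat) (w : 'rV[F]_n) (B : 'M[F]_(s, n)) :
  (col_support (col_mx w B) <= hweight w + col_support B)%N.
Proof.
rewrite -col_support_row -big_split /=; apply: leq_sum => c _.
rewrite col_col_mx col_mx_eq0 negb_and.
by case: eqP; case: eqP.
Qed.

(** Greedy choice: while some [a] outside [U] has [a *m V] of weight at most [t], it becomes a new
    row of [U] and enlarges the support by at most [t]. The rank stops this after at most [j]
    rows. *)
Lemma light_row_space_exists (n j t : nat) (V : 'M[F]_(j, n)) :
  exists s, exists2 U : 'M[F]_(s, j),
    row_free U & (col_support (U *m V) <= s * t)%N /\
      forall a : 'rV_j, ~~ (a <= U)%MS -> (t < hweight (a *m V))%N.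
Proof.
(* Induction on [d], which bounds the number of rows that can still be added. *)
suff ext d s (U : 'M[F]_(s, j)) : (j <= s + d)%N -> row_free U ->
    (col_support (U *m V) <= s * t)%N ->
    exists s, exists2 U : 'M[F]_(s, j),
      row_free U & (col_support (U *m V) <= s * t)%N /\
        forall a : 'rV_j, ~~ (a <= U)%MS -> (t < hweight (a *m V))%N.
  apply: (ext j 0%N 0) => //; first by rewrite /row_free mxrank0.
  rewrite /col_support big1 // => c _.
  by rewrite (flatmx0 (col _ _)) eqxx.
elim: d => [|d IH] in s U *; move=> jsd Ufree Usupp;
  have [ok|/forallPn[a]] := boolP
    [forall a : 'rV_j, ~~ (a <= U)%MS ==> (t < hweight (a *m V))%N].
- by exists s, U => //; split=> // a aU; apply: (implyP (forallP ok a)).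
- rewrite negb_imply => /andP[aU _].
  have : row_free (col_mx a U) by rewrite row_free_col_mx1 Ufree.
  move=> /eqP rk; have := rank_leq_col (col_mx a U); rewrite rk; lia.
- by exists s, U => //; split=> // a aU; apply: (implyP (forallP ok a)).
rewrite negb_imply -leqNgt => /andP[aU at_].
apply: (IH (1 + s)%N (col_mx a U)); first by lia.
  by rewrite row_free_col_mx1 Ufree.
rewrite mul_col_mx (leq_trans (col_support_col_mx _ _)) //.
by rewrite mulnDl mul1n leq_add.
Qed.

(** A nonzero [a] in the row space of [U] gives weight at least 1 since [V] is row free; an [a]
    outside gives weight above [t]. *)
Lemma sum_pow_hweight_le (R : realFieldType) (n j s t : nat) (U : 'M[F]_(s, j))
    (V : 'M[F]_(j, n)) (rho : R) : 0 < rho < 1 -> row_free U -> row_free V ->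
  (forall a : 'rV_j, ~~ (a <= U)%MS -> (t < hweight (a *m V))%N) ->
  \sum_(a : 'rV_j | a != 0) rho ^+ hweight (a *m V) <=
    (q%:R ^+ s - 1) * rho + q%:R ^+ j * rho ^+ t.
Proof.
move=> /andP[rho0 rho1] Ufree Vfree UV.
rewrite (bigID (fun a : 'rV_j => (a <= U)%MS)) /=; apply: lerD.
  have -> : q%:R ^+ s - 1 = \sum_(a : 'rV[F]_j | (a != 0) && (a <= U)%MS) 1 :> R.
    have <- : #|[pred a : 'rV[F]_j | (a <= U)%MS]|%:R = q%:R ^+ s :> R.
      by rewrite card_submx (eqP Ufree) natrX.
    rewrite -sumr_const.
    by rewrite (bigD1 0) ?inE ?sub0mx //= [1 + _]addrC addrK;
      apply: eq_bigl => a; rewrite andbC.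
  rewrite mulr_suml; apply: ler_sum => a /andP[a0 _]; rewrite mul1r.
  rewrite -{2}(expr1 rho) ler_wiXn2l ?(ltW rho0) ?(ltW rho1) //.
  by rewrite hweight_gt0 // mulmx_free_eq0.
apply: (@le_trans _ _ (\sum_(a : 'rV[F]_j) rho ^+ t)).
  rewrite [X in X <= _]big_mkcond /=; apply: ler_sum => a _.
  case: ifP => [/andP[_ aU]|_]; last by rewrite exprn_ge0 // ltW.
  by rewrite ler_wiXn2l ?(ltW rho0) ?(ltW rho1) // ltnW // UV.
by rewrite sumr_const card_mx mul1n -[_ ^+ t *+ _]mulr_natl natrX.
Qed.

End Counting.

(** * Moments of the corank *)

(** The factors are replaced by [b] one at a time, each being at most [b * (1 + y)] in modulus. *)
Lemma dist_prod_const (R : realDomainType) (m : nat) (a : 'I_m -> R) (b y : R) :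
  0 <= b -> 0 <= y -> (forall c, `|a c - b| <= b * y) ->
  `|\prod_c a c - b ^+ m| <= b ^+ m * ((1 + y) ^+ m - 1).
Proof.
move=> b0 y0; elim: m a => [|m IH] a ab.
  by rewrite big_ord0 !expr0 !subrr normr0 mulr0.
rewrite big_ord_recr /=; set P := \prod_(i < m) _; set x := a _.
have -> : P * x - b ^+ m.+1 = (P - b ^+ m) * x + b ^+ m * (x - b).
  by rewrite exprSr; ring.
have -> : b ^+ m.+1 * ((1 + y) ^+ m.+1 - 1) =
  b ^+ m * ((1 + y) ^+ m - 1) * (b * (1 + y)) + b ^+ m * (b * y).
  by rewrite !exprSr; ring.
rewrite (le_trans (ler_normD _ _)) // !normrM; apply: lerD.
  apply: ler_pM => //; first exact: IH.
  rewrite mulrDr mulr1 -[X in _ <= X + _](ger0_norm b0).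
  have -> : x = b + (x - b) by rewrite addrC subrK.
  by rewrite (le_trans (ler_normD _ _)) // lerD2l ab.
by rewrite ger0_norm ?exprn_ge0 // ler_wpM2l ?exprn_ge0 ?ab.
Qed.

Section Moments.
Variables (R : realType) (p : nat) (p_pr : prime p).
Local Notation q := (p%:R : R).

(** The probability of [A] under independent entries with laws [mu i c], grouped by columns since
    [V *m A = 0] is a condition on each column. *)
Definition matrix_mass (n m : nat) (mu : 'I_n -> 'I_m -> 'F_p -> R)
    (A : 'M['F_p]_(n, m)) : R := \prod_c \prod_i mu i c (A i c).

Lemma sum_matrix_mass (n m : nat) (mu : 'I_n -> 'I_m -> 'F_p -> R)
    (h : 'I_m -> pred 'cV['F_p]_n) :
  \sum_A (\prod_c (h c (col c A))%:R) * matrix_mass mu A =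
  \prod_c \sum_(v | h c v) \prod_i mu i c (v i 0).
Proof.
pose g c (v : 'cV['F_p]_n) := (h c v)%:R * \prod_i mu i c (v i 0).
have -> : \prod_c \sum_(v | h c v) \prod_i mu i c (v i 0) =
    \prod_c \sum_v g c v.
  apply: eq_bigr => c _; rewrite big_mkcond; apply: eq_bigr => v _.
  by rewrite /g; case: ifP; rewrite ?mul1r ?mul0r.
rewrite -big_distr_cols; apply: eq_bigr => A _; rewrite -big_split /=.
by apply: eq_bigr => c _; congr (_ * _); apply: eq_bigr => i _; rewrite mxE.
Qed.

(** For each [A] the product counts the row-free [V] with [V *m A = 0]; after the sums are
    exchanged, this condition splits over the columns. *)
Lemma corank_moment (n m j : nat) (mu : 'I_n -> 'I_m -> 'F_p -> R) :
  \sum_A (\prod_(i < j) (q ^+ (n - \rank A) - q ^+ i)) * matrix_mass mu A =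
  \sum_(V : 'M['F_p]_(j, n) | row_free V) \prod_c kernel_mass (mu^~ c) V.
Proof.
have cardq : #|'F_p|%:R = q by rewrite card_Fp.
under eq_bigr => A _ do
  rewrite -mxrank_ker -cardq -count_row_free_submx mulr_suml.
rewrite exchange_big /= [RHS]big_mkcond; apply: eq_bigr => V _.
case: (boolP (row_free V)) => Vfree; last first.
  by rewrite big1 // => A _; rewrite andbF mul0r.
rewrite -(sum_matrix_mass mu (fun c v => V *m v == 0)); apply: eq_bigr => A _.
rewrite andbT; congr (_ * _).
have -> : (V <= kermx A)%MS = [forall c, V *m col c A == 0].
  apply/sub_kermxP/forallP => [VA c|VA].
    by rewrite colE mulmxA VA mul0mx.
  apply/matrixP => i c; rewrite mxE; have /eqP/colP/(_ i) := VA c.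
  by rewrite colE mulmxA -colE !mxE.
case: (boolP [forall c, _]) => [/forallP VA|/forallPn[c VA]].
  by rewrite big1 // => c _; rewrite VA.
by rewrite (bigD1 c) //= (negPf VA) mul0r.
Qed.

End Moments.

(** * Error bounds for the moments at fixed n *)

Section MomentBound.
Variables (R : realType) (p : nat) (p_pr : prime p).
Local Notation q := (p%:R : R).
Variables (n u j t : nat) (mu : 'I_n -> 'I_(n + u) -> 'F_p -> R) (rho : R).
Hypothesis rho01 : 0 < rho < 1.
Hypothesis mu_ge0 : forall i c r, 0 <= mu i c r.
Hypothesis mu_equidistributed : forall c (V : 'M['F_p]_(j, n)),
  `|kernel_mass (mu^~ c) V - q ^- j| <=
    q ^- j * \sum_(a : 'rV_j | a != 0) rho ^+ hweight (a *m V).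

Let q0 : 0 < q. Proof. by rewrite ltr0n prime_gt0. Qed.
Let q2 : 2 <= q. Proof. by rewrite ler_nat prime_gt1. Qed.
Let q1 : 1 <= q. Proof. by rewrite ler1n prime_gt0. Qed.
Let cardq : #|'F_p|%:R = q. Proof. by rewrite card_Fp. Qed.
Let rho0 : 0 < rho. Proof. by case/andP: rho01. Qed.

Local Notation tau := ((1 + rho) / 2 + q ^+ j * rho ^+ t).
Local Notation all_heavy V :=
  [forall a : 'rV['F_p]_j, (a != 0) ==> (t < hweight (a *m V))%N].

(** With [Q = q ^+ s >= 2], the vectors in the row space of [U] contribute
    [(1 + (Q - 1) * rho) / Q <= (1 + rho) / 2], the first term of [tau]; the vectors outside account
    for the second. *)
Lemma kernel_mass_light_le (s : nat) (U : 'M['F_p]_(s, j))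
    (V : 'M['F_p]_(j, n)) c : (0 < s)%N -> row_free U -> row_free V ->
  (forall a : 'rV_j, ~~ (a <= U)%MS -> (t < hweight (a *m V))%N) ->
  kernel_mass (mu^~ c) V <= q ^- (j - s) * tau.
Proof.
move=> s0 Ufree Vfree UV.
have sj : (s <= j)%N by rewrite -(eqP Ufree) rank_leq_col.
have := sum_pow_hweight_le rho01 Ufree Vfree UV; rewrite cardq => sumle.
have /ler_normlP[_] := mu_equidistributed c V; rewrite lerBlDr => kle.
apply: (le_trans kle); set S := \sum_(a | _) _ in sumle *.
set Q := q ^+ s in sumle *; set y := q ^+ j * _ in sumle *.
have -> : q ^- j = q ^- (j - s) * Q^-1 by rewrite -invfM -exprD subnK.
have Q2 : 2 <= Q.
  by rewrite (le_trans q2) // -{1}(expr1 q) ler_weXn2l.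
have Q0 : 0 < Q by lra.
have y0 : 0 <= y by rewrite mulr_ge0 ?exprn_ge0 // ltW.
rewrite -[X in _ + X]mulr1 -mulrDr -mulrA ler_wpM2l ?invr_ge0 ?exprn_ge0 ?(ltW q0) //.
rewrite mulrC ler_pdivrMr //; case/andP: rho01 => _ rho1; nra.
Qed.

Lemma prod_kernel_mass_heavy (V : 'M['F_p]_(j, n)) : row_free V -> all_heavy V ->
  `|\prod_c kernel_mass (mu^~ c) V - q ^- j ^+ (n + u)| <=
    q ^- j ^+ (n + u) * ((1 + q ^+ j * rho ^+ t) ^+ (n + u) - 1).
Proof.
move=> Vfree /forallP heavy.
apply: dist_prod_const => [||c].
- by rewrite invr_ge0 exprn_ge0 // ltW.
- by rewrite mulr_ge0 ?exprn_ge0 // ltW.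
apply: (le_trans (mu_equidistributed c V)).
rewrite ler_wpM2l ?invr_ge0 ?exprn_ge0 ?(ltW q0) //.
(* With an empty light space only the heavy part of the bound remains. *)
have U0free : row_free (0 : 'M['F_p]_(0, j)) by rewrite /row_free mxrank0.
have := @sum_pow_hweight_le _ _ _ _ _ t _ _ _ rho01 U0free Vfree.
rewrite cardq expr0 subrr mul0r add0r; apply=> a aU.
by apply: (implyP (heavy a)); apply: contra aU => /eqP ->; rewrite sub0mx.
Qed.

Lemma all_heavy_row_free (V : 'M['F_p]_(j, n)) : all_heavy V -> row_free V.
Proof.
move=> /forallP heavy; rewrite -kermx_eq0; apply/rowV0P => a /sub_kermxP aV.
apply/eqP; apply: contraT => a0; have := implyP (heavy a) a0.
by rewrite aV /hweight big1 // => i _; rewrite mxE eqxx.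
Qed.

Variable x : R.
Hypothesis x01 : 0 < x <= 1.
Hypothesis tau_le1 : tau <= 1.
Local Notation W := (x ^- (j * t) * (tau * (1 + x * q ^+ j)) ^+ n).

Let x0 : 0 < x. Proof. by case/andP: x01. Qed.
Let tau0 : 0 < tau.
Proof. by rewrite addr_gt0 ?mulr_gt0 ?exprn_gt0 ?addr_gt0 ?invr_gt0. Qed.
Let xq0 : 0 < 1 + x * q ^+ j.
Proof. by rewrite addr_gt0 ?mulr_gt0 ?exprn_gt0. Qed.

(** The factor q^(j-s) per column in the count cancels the q^-(j-s) per column in the mass, so [W]
    depends on neither [s] nor [U]. *)
Lemma count_light_le (s : nat) (U : 'M['F_p]_(s, j)) : row_free U ->
  (\sum_(V : 'M['F_p]_(j, n)) (col_support (U *m V) <= s * t)%N%:R) *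
    (q ^- (j - s) ^+ n * tau ^+ n) <= W.
Proof.
move=> Ufree.
have := @count_small_support _ _ n _ _ (s * t) U _ Ufree x01; rewrite cardq.
have sj : (s <= j)%N by rewrite -(eqP Ufree) rank_leq_col.
set N := \sum_V _ => cnt.
have -> : W = x ^- (j * t) * (q ^+ (j - s) * (1 + x * q ^+ j)) ^+ n *
    (q ^- (j - s) ^+ n * tau ^+ n).
  rewrite -mulrA; congr (_ * _); rewrite -!exprMn; congr (_ ^+ _).
  by field; rewrite expf_neq0 // gt_eqF.
rewrite ler_wpM2r ?mulr_ge0 ?exprn_ge0 ?invr_ge0 ?exprn_ge0 ?(ltW tau0) ?(ltW q0) //.
have xst : 0 < x ^+ (s * t) by rewrite exprn_gt0.
rewrite -ler_pdivlMr // in cnt; apply: (le_trans cnt).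
rewrite mulrC ler_wpM2r ?exprn_ge0 ?mulr_ge0 ?exprn_ge0 ?(ltW xq0) ?(ltW q0) //.
rewrite lef_pV2 ?posrE ?exprn_gt0 // ler_wiXn2l ?(ltW x0) ?leq_mul //.
by case/andP: x01.
Qed.

(** Union bound over the light spaces: [j.+1] values of [s], and at most [q ^+ (j * j)] matrices [U]
    for each. *)
Lemma sum_light_row_free_le :
  \sum_(V : 'M['F_p]_(j, n) | row_free V && ~~ all_heavy V)
    \prod_c kernel_mass (mu^~ c) V <= j.+1%:R * q ^+ (j * j) * W.
Proof.
pose b s := (q ^- (j - s) * tau) ^+ (n + u).
have b0 s : 0 <= b s.
  by rewrite exprn_ge0 ?mulr_ge0 ?invr_ge0 ?exprn_ge0 ?(ltW tau0) ?(ltW q0).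
have W0 : 0 <= W.
  by rewrite mulr_ge0 ?invr_ge0 ?exprn_ge0 ?mulr_ge0 ?(ltW tau0) ?(ltW x0) ?(ltW xq0).
pose f (s : 'I_j.+1) (U : 'M['F_p]_(s, j)) (V : 'M['F_p]_(j, n)) : R :=
  (row_free U && (col_support (U *m V) <= s * t)%N)%:R * b s.
have f0 s U V : 0 <= f s U V by rewrite mulr_ge0.
apply: (@le_trans _ _ (\sum_V \sum_s \sum_U f s U V)).
  rewrite big_mkcond; apply: ler_sum => V _.
  case: ifP => [/andP[Vfree light]|_]; last first.
    by apply: sumr_ge0 => s _; apply: sumr_ge0.
  have [s [U Ufree [Usupp UV]]] := light_row_space_exists t V.
  have sj : (s < j.+1)%N by rewrite ltnS -(eqP Ufree) rank_leq_col.
  (* If [s] were 0, every nonzero [a] would lie outside [U] and [V] would be heavy. *)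
  have s0 : (0 < s)%N.
    rewrite lt0n; apply: contra light => /eqP s0; apply/forallP => a.
    apply/implyP => a0; apply: UV; apply: contra a0 => aU.
    by rewrite -submx0 (submx_trans aU) // submx0 -mxrank_eq0 (eqP Ufree) s0.
  apply: (@le_trans _ _ (f (Ordinal sj) U V)).
    rewrite /f Ufree Usupp mul1r /b -[X in _ ^+ X](card_ord (n + u)) -prodr_const.
    apply: ler_prod => c _; apply/andP; split; last exact: kernel_mass_light_le UV.
    by apply: sumr_ge0 => v _; apply: prodr_ge0.
  rewrite (bigD1 (Ordinal sj)) //= (bigD1 U) //= -addrA lerDl.
  by rewrite addr_ge0 ?sumr_ge0 // => i _; rewrite sumr_ge0.
rewrite exchange_big /=.
apply: (@le_trans _ _ (\sum_(s < j.+1) q ^+ (j * j) * W)); last first.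
  by rewrite sumr_const card_ord -[_ *+ j.+1]mulr_natl mulrA.
apply: ler_sum => s _; rewrite exchange_big /=.
apply: (@le_trans _ _ (\sum_(U : 'M['F_p]_(s, j)) W)); last first.
  rewrite sumr_const card_mx card_Fp // -[_ *+ (p ^ _)]mulr_natl natrX ler_wpM2r //.
  rewrite ler_weXn2l ?q1 //.
  by apply: leq_mul => //; rewrite -ltnS.
apply: ler_sum => U _.
have [Ufree|Ufree] := boolP (row_free U); last first.
  by rewrite big1 // => V _; rewrite /f (negPf Ufree) mul0r.
apply: le_trans (count_light_le Ufree); rewrite mulr_suml; apply: ler_sum => V _.
(* The [u] extra columns contribute a factor at most 1. *)
rewrite /f Ufree /= ler_wpM2l // /b exprD -exprMn -[X in _ <= X]mulr1.
rewrite ler_wpM2l ?exprn_ge0 ?mulr_ge0 ?invr_ge0 ?exprn_ge0 ?(ltW tau0) ?(ltW q0) //.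
rewrite exprn_ile1 ?mulr_ge0 ?invr_ge0 ?exprn_ge0 ?(ltW tau0) ?(ltW q0) //.
rewrite mulr_ile1 ?invr_ge0 ?exprn_ge0 ?(ltW tau0) ?(ltW q0) //.
by rewrite invf_le1 ?exprn_gt0 // exprn_ege1.
Qed.

(** A matrix that is not heavy has a nonzero light combination [a] of its rows, so the count with
    [s = 1] applies to each [a]. *)
Lemma sum_light_le :
  \sum_(V : 'M['F_p]_(j, n) | ~~ all_heavy V) q ^- j ^+ (n + u) <= q ^+ j * W.
Proof.
have W0 : 0 <= W.
  by rewrite mulr_ge0 ?invr_ge0 ?exprn_ge0 ?mulr_ge0 ?(ltW tau0) ?(ltW x0) ?(ltW xq0).
set b := q ^- j ^+ (n + u).
have b0 : 0 <= b by rewrite exprn_ge0 ?invr_ge0 ?exprn_ge0 ?(ltW q0).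
pose f (a : 'rV['F_p]_j) (V : 'M['F_p]_(j, n)) : R :=
  ((a != 0) && (col_support (a *m V) <= 1 * t)%N)%:R * b.
have f0 a V : 0 <= f a V by rewrite mulr_ge0.
apply: (@le_trans _ _ (\sum_V \sum_a f a V)).
  rewrite big_mkcond; apply: ler_sum => V _.
  case: ifP => [/forallPn[a]|_]; last by apply: sumr_ge0.
  rewrite negb_imply -leqNgt => /andP[a0 at_].
  rewrite (bigD1 a) //= /f a0 col_support_row mul1n at_ mul1r lerDl.
  by apply: sumr_ge0 => i _; rewrite mulr_ge0.
rewrite exchange_big /=.
apply: (@le_trans _ _ (\sum_(a : 'rV['F_p]_j) W)); last first.
  by rewrite sumr_const card_mx card_Fp // mul1n -[_ *+ (p ^ _)]mulr_natl natrX.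
apply: ler_sum => a _; have [->|a0] := eqVneq a 0.
  by rewrite big1 // => V _; rewrite /f eqxx mul0r.
have j0 : (0 < j)%N.
  by rewrite lt0n; apply: contra a0 => /eqP j0; apply/eqP/rowP => i;
    have := ltn_ord i; rewrite {2}j0.
have afree : row_free a by rewrite /row_free rank_rV a0.
apply: le_trans (count_light_le afree); rewrite mulr_suml; apply: ler_sum => V _.
rewrite /f a0 /= ler_wpM2l // /b -exprMn exprD -[X in _ <= X]mulr1.
apply: ler_pM; rewrite ?exprn_ge0 ?invr_ge0 ?exprn_ge0 ?(ltW q0) //; last first.
  rewrite exprn_ile1 ?invr_ge0 ?exprn_ge0 ?(ltW q0) //.
  by rewrite invf_le1 ?exprn_gt0 // exprn_ege1.
apply: lerXn2r; rewrite ?nnegrE ?mulr_ge0 ?invr_ge0 ?exprn_ge0 ?(ltW tau0) ?(ltW q0) //.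
rewrite -{1}(subnK j0) exprD expr1 invfM ler_wpM2l ?invr_ge0 ?exprn_ge0 ?(ltW q0) //.
(* One factor [q^-1] is at most 1/2, hence at most [tau]. *)
apply: (@le_trans _ _ (2^-1)); first by rewrite lef_pV2 ?posrE.
have : 0 <= q ^+ j * rho ^+ t by rewrite mulr_ge0 ?exprn_ge0 ?ltW.
by have := rho0; lra.
Qed.

Lemma moment_bound :
  `|\sum_(V : 'M['F_p]_(j, n) | row_free V) \prod_c kernel_mass (mu^~ c) V
      - q ^- (j * u)| <=
    ((1 + q ^+ j * rho ^+ t) ^+ (n + u) - 1)
    + (j.+1%:R * q ^+ (j * j) + q ^+ j) * W.
Proof.
set b := q ^- j ^+ (n + u); set G := (1 + _) ^+ _ - 1.
pose Q : 'M['F_p]_(j, n) -> R := fun V => \prod_c kernel_mass (mu^~ c) V.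
have G0 : 0 <= G.
  by rewrite subr_ge0 exprn_ege1 // lerDl mulr_ge0 ?exprn_ge0 ?ltW.
have Q0 V : 0 <= Q V.
  by apply: prodr_ge0 => c _; apply: sumr_ge0 => v _; apply: prodr_ge0.
(* Written as the total uniform mass of all [V], the limit can be compared with the moment matrix by
   matrix. *)
have bE : q ^- (j * u) = \sum_(V : 'M['F_p]_(j, n)) b.
  rewrite sumr_const card_mx card_Fp // -[b *+ _]mulr_natl natrX /b exprVn -exprM.
  by rewrite mulnDr exprD; field; rewrite !expf_neq0 // gt_eqF.
have b0 : 0 <= b by rewrite exprn_ge0 ?invr_ge0 ?exprn_ge0 ?(ltW q0).
rewrite bE (bigID (fun V => all_heavy V)) /=.
rewrite [X in _ - X](bigID (fun V => all_heavy V)) /=.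
rewrite (eq_bigl (fun V => all_heavy V)) => [|V]; last first.
  by case: (boolP (all_heavy V)) => [/all_heavy_row_free ->|]; rewrite ?andbF.
rewrite opprD addrACA -sumrB.
have heavyle : `|\sum_(V : 'M['F_p]_(j, n) | all_heavy V) (Q V - b)| <= G.
  rewrite (le_trans (ler_norm_sum _ _ _)) //.
  apply: (@le_trans _ _ (\sum_(V : 'M['F_p]_(j, n)) b * G)).
    rewrite big_mkcond; apply: ler_sum => V _; case: ifP => [heavy|_].
      exact: prod_kernel_mass_heavy (all_heavy_row_free heavy) heavy.
    exact: mulr_ge0.
  rewrite -mulr_suml -bE -[X in _ <= X]mul1r ler_wpM2r //.
  by rewrite invf_le1 ?exprn_gt0 // exprn_ege1.
have light1 := sum_light_row_free_le; have light2 := sum_light_le.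
apply: (le_trans (ler_normD _ _)); apply: lerD; first exact: heavyle.
rewrite mulrDl; apply: (le_trans (ler_normB _ _)).
rewrite !ger0_norm ?sumr_ge0 // => [|V _]; last exact: Q0.
exact: lerD.
Qed.

End MomentBound.

(** * Asymptotics of the error terms and convergence of the moments *)

Lemma bernoulli_le (R : realDomainType) (k : R) (n : nat) :
  0 <= k -> 1 + n%:R * k <= (1 + k) ^+ n.
Proof.
move=> k0; elim: n => [|n IH]; first by rewrite mul0r addr0.
have n0 : 0 <= n%:R :> R by [].
rewrite exprS -natr1; apply: (@le_trans _ _ ((1 + k) * (1 + n%:R * k))); first by nra.
by rewrite ler_wpM2l // addr_ge0.
Qed.

Lemma cvg_expr_divn (R : realType) (z : R) (L : nat) : `|z| < 1 -> (0 < L)%N ->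
  (z ^+ (n %/ L)) @[n --> \oo] --> 0.
Proof. by move=> z1 L0; exact: (cvg_comp _ _ (cvg_divnr _ L0) (cvg_expr z1)). Qed.

Lemma cvg_linear_mul_expr_divn (R : realType) (rho : R) (u L : nat) :
  0 < rho < 1 -> (0 < L)%N ->
  ((n + u)%:R * rho ^+ (n %/ L)) @[n --> \oo] --> (0 : R).
Proof.
move=> /andP[rho0 rho1] L0.
(* Here [rho = 1 - 2 * k], so [(1 + k) * rho < 1], while by Bernoulli [(1 + k) ^+ t] dominates the
   linear factor up to a constant. *)
pose k := (1 - rho) / 2; have k0 : 0 < k by rewrite /k; lra.
pose sigma := (1 + k) * rho.
have sigma01 : 0 < sigma < 1.
  rewrite mulr_gt0 ?addr_gt0 //= /sigma.
  have -> : rho = 1 - 2 * k by rewrite /k; lra.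
  nra.
pose C : R := (L + u)%:R * ((1 + k) / k).
have C0 : 0 <= C by rewrite mulr_ge0 // divr_ge0 ?addr_ge0 // ltW.
apply: (@squeeze_cvgr _ _ _ _ (fun=> 0) (fun n => C * sigma ^+ (n %/ L))).
- near=> n; rewrite mulr_ge0 ?exprn_ge0 ?(ltW rho0) //=.
  set t := (n %/ L)%N.
  have nt : (n + u)%:R <= (L + u)%:R * t.+1%:R :> R.
    rewrite -natrM ler_nat.
    have : (n < t.+1 * L)%N by rewrite -ltn_divLR.
    by rewrite mulnDl mulnS [(u * _)%N]mulnS; lia.
  have tk : t.+1%:R <= (1 + k) / k * (1 + k) ^+ t :> R.
    rewrite mulrAC -exprS ler_pdivlMr //.
    by apply: le_trans (bernoulli_le _ (ltW k0)); rewrite lerDr.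
  rewrite /sigma exprMn mulrA ler_wpM2r ?exprn_ge0 ?(ltW rho0) //.
  by apply: (le_trans nt); rewrite /C -mulrA ler_wpM2l.
- exact: cvg_cst.
- rewrite -[X in _ --> X](mulr0 C); apply: cvgMl_tmp; apply: cvg_expr_divn => //.
  by case/andP: sigma01 => s0 s1; rewrite gtr0_norm.
Unshelve. all: by end_near. Qed.

Section MomentLimit.
Variables (R : realType) (p : nat) (p_pr : prime p) (eps : R) (eps0 : 0 < eps).
Local Notation q := (p%:R : R).
Variables (u : nat) (mu : forall n, 'I_n -> 'I_(n + u) -> 'F_p -> R).
Hypothesis mu_balanced : forall n i c, balanced_law eps (@mu n i c).

Lemma corank_moment_cvg (j : nat) :
  (\sum_A (\prod_(i < j) (q ^+ (n - \rank A) - q ^+ i)) * matrix_mass (@mu n) A)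
    @[n --> \oo] --> q ^- (j * u).
Proof.
have [rho rho01 rhoP] := kernel_mass_equidistribution p_pr eps0.
have /andP[rho0 rho1] := rho01.
have q0 : 0 < q by rewrite ltr0n prime_gt0.
have qj0 : 0 < q ^+ j by rewrite exprn_gt0.
have qj1 : 1 <= q ^+ j by rewrite exprn_ege1 // ler1n prime_gt0.
(* [theta] is the midpoint of [(1 + rho) / 2] and 1, leaving room for the vanishing part of [tau];
   [eta] is small enough that [(1 + eta) ^+ 2 * theta < 1]. *)
pose theta := (3 + rho) / 4; pose eta := (1 - theta) / 2.
have eta0 : 0 < eta by rewrite /eta /theta; lra.
have eta1 : eta <= 1 by rewrite /eta /theta; lra.
pose x := eta / q ^+ j.
have x0 : 0 < x by rewrite divr_gt0.
have x01 : 0 < x <= 1.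
  by rewrite x0 ler_pdivrMr // mul1r (le_trans eta1).
have xq : 1 + x * q ^+ j = 1 + eta by rewrite divfK // gt_eqF.
(* [L] is so large that, for the threshold [t = n %/ L], the Chernoff cost [x ^- (j * t)] is at most
   [(1 + eta) ^+ n]. *)
pose L := (Num.Def.archi_bound (x ^- j / eta)).+1.
have xL : x ^- j <= (1 + eta) ^+ L.
  apply: le_trans (bernoulli_le _ (ltW eta0)).
  have : x ^- j / eta <= L%:R.
    apply: (le_trans (ltW (archi_boundP _))); last by rewrite ler_nat.
    by rewrite divr_ge0 ?invr_ge0 ?exprn_ge0 // ltW.
  by rewrite ler_pdivrMr // => /le_trans; apply; rewrite lerDr.
pose t n := (n %/ L)%N.
pose psi := (1 + eta) ^+ 2 * theta.
have psi0 : 0 <= psi by rewrite mulr_ge0 ?exprn_ge0 ?addr_ge0 ?(ltW eta0) // /theta; lra.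
have psi1 : psi < 1.
  have -> : psi = (1 + eta) ^+ 2 * (1 - 2 * eta) by rewrite /psi /eta; field.
  by rewrite expr2; nra.
pose D : R := j.+1%:R * q ^+ (j * j) + q ^+ j.
have D0 : 0 <= D by rewrite addr_ge0 ?mulr_ge0 ?exprn_ge0 ?(ltW q0).
(* The exponential comes from [1 + y <= expR y] in each of the [n + u] columns; its argument tends
   to 0 because [t n] grows linearly. *)
pose B n := expR (q ^+ j * ((n + u)%:R * rho ^+ t n)) - 1 + D * psi ^+ n.
have B_cvg : B n @[n --> \oo] --> 0.
  rewrite -[X in _ --> X](addr0 0); apply: cvgD; last first.
    rewrite -[X in _ --> X](mulr0 D); apply: cvgMl_tmp.
    have psin : `|psi| < 1 by rewrite ger0_norm.
    exact: cvg_expr psin.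
  rewrite -[X in _ --> X](subrr 1); apply: cvgB; last exact: cvg_cst.
  rewrite -[X in _ --> X]expR0; apply: continuous_cvg; first exact: continuous_expR.
  rewrite -[X in _ --> X](mulr0 (q ^+ j)); apply: cvgMl_tmp.
  exact: cvg_linear_mul_expr_divn.
have tau_near : \forall n \near \oo, (1 + rho) / 2 + q ^+ j * rho ^+ t n <= theta.
  have : (q ^+ j * rho ^+ t n) @[n --> \oo] --> 0.
    rewrite -[X in _ --> X](mulr0 (q ^+ j)); apply: cvgMl_tmp; apply: cvg_expr_divn => //.
    by rewrite gtr0_norm.
  move=> /cvgrPdist_lt/(_ ((1 - rho) / 4)) H.
  have /H : 0 < (1 - rho) / 4 by lra.
  apply: filterS => n; rewrite sub0r normrN => /(le_lt_trans (ler_norm _)).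
  by rewrite /theta; lra.
apply/cvgrPdist_lt => e e0.
move/cvgrPdist_lt : B_cvg => /(_ e e0); apply: filterS2 tau_near => n tau_n.
rewrite sub0r normrN => /(le_lt_trans (ler_norm _)); apply: le_lt_trans.
rewrite distrC corank_moment //.
have mu0 i c r : 0 <= @mu n i c r by have [h _ _] := mu_balanced i c.
apply: (le_trans (moment_bound p_pr rho01 mu0 _ x01 _)).
- by move=> c V; apply: rhoP => i.
- by apply: (le_trans tau_n); rewrite /theta; lra.
rewrite /B; apply: lerD.
  rewrite lerD2r mulrCA expRM_natl.
  apply: lerXn2r; rewrite ?nnegrE ?expR_ge0 ?expR_ge1Dx //.
  by rewrite addr_ge0 ?mulr_ge0 ?exprn_ge0 ?(ltW q0) ?(ltW rho0).
rewrite ler_wpM2l // xq /psi.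
apply: (@le_trans _ _ ((1 + eta) ^+ n * (theta * (1 + eta)) ^+ n)); last first.
  by rewrite -exprMn mulrCA -expr2 mulrC.
have tau0 : 0 <= (1 + rho) / 2 + q ^+ j * rho ^+ t n.
  by rewrite addr_ge0 ?mulr_ge0 ?exprn_ge0 ?addr_ge0 ?(ltW q0) ?(ltW rho0).
apply: ler_pM.
- by rewrite invr_ge0 exprn_ge0 // ltW.
- by rewrite exprn_ge0 // mulr_ge0 // addr_ge0 // ltW.
- rewrite exprM -exprVn; apply: (@le_trans _ _ ((1 + eta) ^+ L ^+ t n)).
    by apply: lerXn2r => //; rewrite nnegrE ?invr_ge0 exprn_ge0 ?addr_ge0 // ltW.
  rewrite -exprM ler_weXn2l //; first by rewrite lerDl ltW.
  by rewrite mulnC leq_trunc_div.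
have eta_ge0 : 0 <= 1 + eta by rewrite addr_ge0 // ltW.
have theta0 : 0 <= theta by rewrite /theta; lra.
apply: lerXn2r; rewrite ?nnegrE; [exact: mulr_ge0|exact: mulr_ge0|].
exact: ler_wpM2r.
Qed.

End MomentLimit.

(** * Interpolation and Euler's series *)

Section Interpolation.
Variables (R : realType) (q : R) (q1 : 1 < q).

Let q0 : 0 < q. Proof. exact: lt_trans q1. Qed.
Let qX_gt0 l : 0 < q ^+ l. Proof. exact: exprn_gt0. Qed.

Definition newton_basis (j : nat) (x : R) : R := \prod_(l < j) (x - q ^+ l).

(** The divided difference at q^0, ..., q^(k+i) of the function equal to 1 at q^k and 0 at the other
    nodes. *)
Definition newton_coef (k i : nat) : R :=
  (-1) ^+ i / (newton_basis k (q ^+ k) * \prod_(l < i) (q ^+ (k + l.+1) - q ^+ k)).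

(* The Lagrange basis polynomial at the node q^k for the nodes
   q^0, ..., q^(k + m). *)
Definition lagrange_basis (k m : nat) (x : R) : R :=
  newton_basis k x / newton_basis k (q ^+ k) *
  \prod_(l < m) ((q ^+ (k + l.+1) - x) / (q ^+ (k + l.+1) - q ^+ k)).

Let node_gap_gt0 k l : 0 < q ^+ (k + l.+1) - q ^+ k.
Proof. by rewrite subr_gt0 ltr_eXn2l // addnS ltnS leq_addr. Qed.

Lemma newton_basis_gt0 k K : (k <= K)%N -> 0 < newton_basis k (q ^+ K).
Proof.
move=> kK; apply: prodr_gt0 => l _.
by rewrite subr_gt0 ltr_eXn2l // (leq_trans _ kK).
Qed.

Lemma newton_basis_eq0 k K : (K < k)%N -> newton_basis k (q ^+ K) = 0.
Proof. by move=> Kk; rewrite /newton_basis (bigD1 (Ordinal Kk)) //= subrr mul0r. Qed.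

(** The factor of a new node at distance e from q^k is 1 - (x - q^k) / e, so each new node adds
    exactly one Newton term. *)
Lemma lagrange_basis_newton k m x :
  lagrange_basis k m x =
  \sum_(i < m.+1) newton_coef k i * newton_basis (k + i) x.
Proof.
elim: m => [|m IH].
  rewrite big_ord1 /lagrange_basis /newton_coef !big_ord0 addn0 expr0 !mulr1.
  by rewrite mul1r mulrC.
rewrite big_ord_recr -IH /= /lagrange_basis big_ord_recr /=.
have bk : newton_basis k (q ^+ k) != 0 by rewrite gt_eqF // newton_basis_gt0.
have bm : q ^+ (k + m.+1) - q ^+ k != 0 by rewrite gt_eqF.
rewrite /newton_coef; set P := \prod_(l < m) (_ / _).
rewrite [X in _ / (_ * X)]big_ord_recr /=.
set D := \prod_(l < m) (_ - _).
have D0 : D != 0 by apply/prodf_neq0 => l _; rewrite gt_eqF.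
have -> : newton_basis (k + m.+1) x =
    newton_basis k x * (x - q ^+ k) * ((-1) ^+ m * (P * D)).
  rewrite {1}/newton_basis big_split_ord /= -mulrA; congr (_ * _).
  rewrite big_ord_recl /= addn0; congr (_ * _).
  rewrite -big_split /= -[X in (-1) ^+ X]card_ord -prodr_const -big_split /=.
  apply: eq_bigr => l _; rewrite divfK ?gt_eqF //=.
  by rewrite mulN1r opprB.
rewrite exprS; set b := newton_basis k (q ^+ k) in bk *; set N := newton_basis k x.
set e := q ^+ (k + m.+1) - q ^+ k in bm *; set g := (-1) ^+ m.
have -> : -1 * g / (b * (D * e)) * (N * (x - q ^+ k) * (g * (P * D))) =
    - (g * g) * (N * (x - q ^+ k) * P) / (b * e).
  by field; rewrite bk bm D0.
rewrite -expr2 sqrr_sign -[q ^+ (k + m.+1)](subrK (q ^+ k)) -/e.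
by field; rewrite bk bm.
Qed.

(* The Bonferroni-type inequalities: outside the nodes the sign comes from the m
   factors with node above q^k, and the indicator vanishes. *)
Lemma lagrange_basis_alternating k m K :
  0 <= (-1) ^+ m * (lagrange_basis k m (q ^+ K) - (K == k)%:R).
Proof.
have bk : 0 < newton_basis k (q ^+ k) by apply: newton_basis_gt0.
rewrite /lagrange_basis; case: (ltngtP K k) => [Kk|kK|->].
- by rewrite newton_basis_eq0 // !mul0r subrr mulr0.
- rewrite subr0 mulrCA mulr_ge0 ?divr_ge0 ?(ltW bk)
    ?(ltW (newton_basis_gt0 (ltnW kK))) //.
  rewrite -[X in (-1) ^+ X]card_ord -prodr_const -big_split /=.
  have [Kkm|kmK] := leqP K (k + m).
    have l0 : (K - k.+1 < m)%N by lia.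
    rewrite (bigD1 (Ordinal l0)) //= (_ : (k + (K - k.+1).+1 = K)%N); last by lia.
    by rewrite subrr mul0r mulr0 mul0r.
  apply: prodr_ge0 => l _; rewrite mulN1r -mulNr opprB divr_ge0 //; last exact: ltW.
  rewrite subr_ge0 ler_weXn2l ?(ltW q1) //.
  by have := ltn_ord l; lia.
- rewrite divff ?gt_eqF // mul1r big1 ?subrr ?mulr0 // => l _.
  by rewrite divff ?gt_eqF.
Qed.

End Interpolation.

Section Euler.
Variables (R : realType) (q : R) (q2 : 2 <= q).

Let q0 : 0 < q. Proof. exact: lt_le_trans q2. Qed.
Let q1 : 1 <= q. Proof. by apply: le_trans q2; rewrite ler1n. Qed.
Let qX_gt0 l : 0 < q ^+ l. Proof. exact: exprn_gt0. Qed.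

Definition euler_coef (i : nat) : R := (-1) ^+ i / \prod_(l < i) (q ^+ l.+1 - 1).

Definition euler_term (s i : nat) : R := euler_coef i * q ^- s ^+ i.

Let gap_ge l : q ^+ l <= q ^+ l.+1 - 1.
Proof.
rewrite exprS; have : 1 <= q ^+ l by rewrite exprn_ege1.
by have := qX_gt0 l; have := q2; nra.
Qed.

Let gap_gt0 l : 0 < q ^+ l.+1 - 1. Proof. exact: lt_le_trans (gap_ge l). Qed.

(** The first factor [q - 1] is only known to be at least 1, the later ones at least 2; hence the
    leading 2. *)
Lemma norm_euler_coef_le i : `|euler_coef i| <= 2 * 2^-1 ^+ i.
Proof.
have D0 : 0 < \prod_(l < i) (q ^+ l.+1 - 1) by apply: prodr_gt0.
rewrite normrM normrX normrN1 expr1n mul1r gtr0_norm ?invr_gt0 //.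
rewrite exprVn -[2 * _]invrK lef_pV2 ?posrE ?invr_gt0 ?mulr_gt0 ?invr_gt0 ?exprn_gt0 //.
rewrite invfM invrK; elim: i {D0} => [|i IH]; first by rewrite big_ord0; lra.
rewrite big_ord_recr /= exprS; case: i IH => [_|i IH].
  by rewrite big_ord0 mul1r expr0 mulr1 mulVf // expr1; have := q2; lra.
rewrite mulrCA [X in _ <= X]mulrC; apply: ler_pM => //.
apply: (le_trans q2); apply: le_trans (gap_ge _).
by rewrite exprS ler_peMr ?(ltW q0) // exprn_ege1.
Qed.

Lemma norm_euler_term_le s i : `|euler_term s i| <= geometric 2 2^-1 i.
Proof.
rewrite normrM -[X in _ <= X]mulr1 ler_pM // ?norm_euler_coef_le //.
rewrite ger0_norm ?exprn_ge0 ?invr_ge0 ?(ltW (qX_gt0 _)) //.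
rewrite exprn_ile1 ?invr_ge0 ?(ltW (qX_gt0 _)) //.
by rewrite invf_le1 // exprn_ege1.
Qed.

Lemma is_cvg_series_euler s : cvgn (series (euler_term s)).
Proof.
apply: normed_cvg.
apply: (@series_le_cvg _ _ (geometric 2 2^-1)) => [i|i|i|].
- by rewrite normr_ge0.
- by rewrite mulr_ge0 ?exprn_ge0.
- exact: norm_euler_term_le.
by apply: is_cvg_geometric_series; rewrite gtr0_norm ?invf_lt1 // ltr1n.
Qed.

Definition euler_sum (s : nat) : R := limn (series (euler_term s)).

(** Rests on [(q ^+ i.+1 - 1) * euler_coef i.+1 = - euler_coef i], used on partial sums with indices
    shifted by one. *)
Lemma euler_sumS s : euler_sum s = (1 - q ^- s.+1) * euler_sum s.+1.
Proof.
have series_shift m : series (euler_term s) m.+1 =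
    series (euler_term s.+1) m.+1 - q ^- s.+1 * series (euler_term s.+1) m.
  apply/eqP; rewrite -subr_eq0 opprB addrA addrAC.
  rewrite /series /= -sumrB big_nat_recl //= {1 2}/euler_term !expr0.
  rewrite subrr add0r mulr_sumr -big_split /=.
  apply/eqP/big1_seq => i _.
  rewrite /euler_term /euler_coef big_ord_recr /=.
  set D := \prod_(l < i) _.
  have D0 : D != 0 by apply/prodf_neq0 => l _; rewrite gt_eqF.
  have e0 : q ^+ i.+1 - 1 != 0 by rewrite gt_eqF.
  have qs : q ^- s = q * q ^- s.+1.
    by rewrite exprS; field; rewrite gt_eqF ?expf_neq0 // gt_eqF.
  rewrite qs; set y := q ^- s.+1; rewrite exprMn !exprS; rewrite exprS in e0.
  by field; rewrite D0 e0.
apply: cvg_lim => //; rewrite -cvg_shiftS /=.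
rewrite (_ : (fun n => _) = (fun m => series (euler_term s.+1) m.+1
    - q ^- s.+1 * series (euler_term s.+1) m)); last exact/funext.
rewrite mulrBl mul1r; apply: cvgB; last by apply: cvgMl_tmp; exact: is_cvg_series_euler.
rewrite (cvg_shiftS (series (euler_term s.+1))); exact: is_cvg_series_euler.
Qed.

Lemma euler_sum_prod s :
  euler_sum 0 = \prod_(1 <= i < s.+1) (1 - q ^- i) * euler_sum s.
Proof.
elim: s => [|s IH]; first by rewrite big_geq // mul1r.
by rewrite [in RHS]big_nat_recr //= -mulrA -euler_sumS IH.
Qed.

Lemma euler_sum_dist1_le s : `|euler_sum s - 1| <= 2 * q ^- s.
Proof.
have qs0 : 0 <= q ^- s by rewrite invr_ge0 ltW.
have partial m : `|series (euler_term s) m.+1 - 1| <= 2 * q ^- s.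
  rewrite /series /= big_nat_recl //= {1}/euler_term /euler_coef big_ord0.
  rewrite !expr0 divr1 mulr1 [1 + _]addrC addrK (le_trans (ler_norm_sum _ _ _)) //.
  apply: (@le_trans _ _ (\sum_(0 <= i < m) q ^- s * 2^-1 ^+ i)).
    apply: ler_sum => i _; rewrite normrM mulrC.
    apply: ler_pM => //.
      rewrite ger0_norm ?exprn_ge0 // exprS -[X in _ <= X]mulr1 ler_wpM2l //.
      by rewrite exprn_ile1 // invf_le1 // exprn_ege1.
    by apply: (le_trans (norm_euler_coef_le _)); rewrite exprS mulrA divff // mul1r.
  rewrite -mulr_sumr mulrC ler_wpM2r //.
  have -> : \sum_(0 <= i < m) 2^-1 ^+ i = 2 - 2 * 2^-1 ^+ m :> R.
    elim: m => [|m IH]; first by rewrite big_geq // expr0 mulr1 subrr.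
    by rewrite big_nat_recr //= IH exprS; field.
  by rewrite gerBl mulr_ge0 // exprn_ge0.
have lim_dist : `|series (euler_term s) m.+1 - 1| @[m --> \oo] -->
    `|euler_sum s - 1|.
  apply: cvg_norm; apply: cvgB; last exact: cvg_cst.
  by rewrite (cvg_shiftS (series (euler_term s))); exact: is_cvg_series_euler.
rewrite -(cvg_lim _ lim_dist) //; apply: limr_le; first exact: cvgP lim_dist.
exact: nearW.
Qed.

Lemma cvg_qXV : q ^- s @[s --> \oo] --> 0.
Proof.
have qV1 : `|q^-1| < 1.
  by rewrite gtr0_norm ?invr_gt0 // invf_lt1 //; have := q2; lra.
rewrite (_ : (fun s => q ^- s) = (fun s => q^-1 ^+ s)); first exact: cvg_expr qV1.
by apply/funext => s; rewrite exprVn.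
Qed.

Lemma cvg_euler_sum : euler_sum s @[s --> \oo] --> (1 : R).
Proof.
apply/cvgrPdist_lt => e e0.
have e2 : 0 < e / 2 by rewrite divr_gt0.
move/cvgrPdist_lt: cvg_qXV => /(_ _ e2); apply: filterS => s.
rewrite sub0r normrN gtr0_norm ?invr_gt0 // distrC.
rewrite ltr_pdivlMr // mulrC; apply: le_lt_trans; exact: euler_sum_dist1_le.
Qed.

(** The partial product up to [s] is [euler_sum 0 / euler_sum s] once [euler_sum s] is nonzero, and
    [euler_sum s] tends to 1. *)
Lemma infinite_prod_euler : infinite_prod (fun i => 1 - q ^- i) = euler_sum 0.
Proof.
apply: cvg_lim => //; rewrite -[X in _ --> X]mulr1 -[X in _ * X]invr1.
have near_neq0 : \forall s \near \oo, euler_sum s != 0.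
  move/cvgrPdist_lt: cvg_euler_sum => /(_ _ ltr01); apply: filterS => s.
  by apply: contraTneq => ->; rewrite subr0 normr1 ltxx.
apply: cvg_trans (cvgMl_tmp (cvgV (oner_neq0 R) cvg_euler_sum)).
apply: near_eq_cvg; apply: filterS near_neq0 => s s0.
by rewrite (euler_sum_prod s) mulfK.
Qed.

Lemma euler_sum_eq s : euler_sum s =
  (\prod_(1 <= i < s.+1) (1 - q ^- i)^-1) * infinite_prod (fun i => 1 - q ^- i).
Proof.
rewrite infinite_prod_euler (euler_sum_prod s) mulrA prodfV mulVf ?mul1r //.
rewrite prodf_seq_neq0; apply/allP => i; rewrite mem_index_iota => /andP[i0 _].
rewrite subr_eq0 eq_sym lt_eqF // invf_lt1 // exprn_egt1 -?lt0n //.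
by have := q2; lra.
Qed.

End Euler.

(** * Laws of random matrices *)

(** Pulling [q ^+ k] out of each gap produces q^(k i), which turns the q^-u of the moments into
    Euler's argument q^-(k+u). *)
Lemma newton_limit_series (R : realType) (q : R) (k u m : nat) : 2 <= q ->
  \sum_(i < m.+1) newton_coef q k i * q ^- ((k + i) * u) =
  q ^- (k * u) / newton_basis q k (q ^+ k) *
    series (euler_term q (k + u)) m.+1.
Proof.
move=> q2; have q0 : 0 < q by lra.
have qX j : q ^+ j != 0 by rewrite expf_neq0 // gt_eqF.
rewrite /series /= big_mkord mulr_sumr; apply: eq_bigr => i _.
rewrite /newton_coef /euler_term /euler_coef.
have -> : \prod_(l < i) (q ^+ (k + l.+1) - q ^+ k) =
    q ^+ k ^+ i * \prod_(l < i) (q ^+ l.+1 - 1).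
  rewrite -[X in _ = _ ^+ X * _]card_ord -prodr_const -big_split /=.
  by apply: eq_bigr => l _; rewrite mulrBr mulr1 -exprD.
have bk : newton_basis q k (q ^+ k) != 0.
  by rewrite gt_eqF // newton_basis_gt0 //; lra.
have D0 : \prod_(l < i) (q ^+ l.+1 - 1) != 0.
  apply/prodf_neq0 => l _; rewrite gt_eqF // subr_gt0 exprn_egt1 //; lra.
rewrite exprVn -!exprM !mulnDl !exprD [(i * u)%N]mulnC.
by field; rewrite bk D0 !qX.
Qed.

Lemma newton_basis_node (R : realType) (q : R) (k : nat) : q != 0 ->
  newton_basis q k (q ^+ k) =
  q ^+ (k * k) * \prod_(1 <= i < k.+1) (1 - q ^- i).
Proof.
move=> q0; rewrite /newton_basis (reindex_inj rev_ord_inj) big_add1 big_mkord /=.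
rewrite exprM -[X in _ = _ ^+ X * _]card_ord -prodr_const -big_split /=.
apply: eq_bigr => l _; rewrite mulrBr mulr1; congr (_ - _).
by rewrite -[in X in X / _](subnK (ltn_ord l)) exprD mulfK // expf_neq0.
Qed.

Section FiniteRandomVariable.
Variables (d : measure_display) (T : measurableType d) (R : realType).
Variables (P : probability T R) (S : finType) (X : T -> S).
Hypothesis mX : forall a, measurable [set w | X w = a].

Lemma finite_rv_prob (Q : pred S) :
  P [set w | Q (X w)] = (\sum_(a | Q a) P [set w | X w = a])%E.
Proof.
have -> : [set w | Q (X w)] = \bigcup_(a in [set` Q]) [set w | X w = a].
  by apply/seteqP; split=> [w Qw|w [a /= Qa ->]] //; exists (X w).
rewrite measure_fin_bigcup //; last by move=> a b _ _ [w [/= -> ->]].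
by rewrite -(@bigfs _ _ _ _ (index_enum S)) ?index_enum_uniq // => a _;
  rewrite mem_index_enum.
Qed.

End FiniteRandomVariable.

Section RandomMatrixLaw.
Variables (d : measure_display) (T : measurableType d) (R : realType).
Variables (P : probability T R) (eps : R) (p m n : nat).
Variable M : T -> 'M['F_p]_(m, n).
Hypothesis M_balanced : eps_balanced P eps M.

Definition entry_law (i : 'I_m) (c : 'I_n) (r : 'F_p) : R :=
  fine (P [set w | M w i c = r]).

Lemma entry_lawE i c r : (entry_law i c r)%:E = P [set w | M w i c = r].
Proof.
rewrite fineK //; apply: fin_num_measure.
by case: M_balanced => mM _ _; exact: (mM i c [set r]).
Qed.

Lemma entry_law_balanced i c : balanced_law eps (entry_law i c).
Proof.
have [mM _ le_eps] := M_balanced.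
split=> [r||r]; first exact: fine_ge0.
  apply: EFin_inj; rewrite -sumEFin.
  under eq_bigr => r _ do rewrite entry_lawE.
  rewrite -(@finite_rv_prob _ _ _ P _ (fun w => M w i c) _ predT) => [|r].
    by rewrite (_ : [set w | _] = setT) ?probability_setT //; apply/seteqP; split.
  exact: (mM i c [set r]).
by rewrite -lee_fin entry_lawE.
Qed.

Lemma matrix_law A : P [set w | M w = A] = (matrix_mass entry_law A)%:E.
Proof.
have [_ indep _] := M_balanced.
have -> : [set w | M w = A] = \bigcap_(ij in [set` (finset.setT : {set 'I_m * 'I_n})])
    ((fun w => M w ij.1 ij.2) @^-1` [set A ij.1 ij.2]).
  apply/seteqP; split=> [w /= MA ij _ /=|w MA /=]; first by rewrite MA.
  by apply/matrixP => i c; apply: (MA (i, c)); rewrite /= inE.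
apply: (etrans (indep finset.setT (fun ij => [set A ij.1 ij.2]))).
rewrite (eq_bigl xpredT) => [|ij]; last by rewrite inE.
under eq_bigr => ij _ do rewrite -[P _]entry_lawE.
rewrite prodEFin; congr EFin; rewrite /matrix_mass exchange_big /=.
by rewrite (pair_big xpredT xpredT (fun i c => entry_law i c (A i c))).
Qed.

Lemma prob_corank (k : nat) :
  P [set w | (\rank (M w) + k)%N = m] =
  (\sum_A ((m - \rank A)%N == k)%:R * matrix_mass entry_law A)%:E.
Proof.
have mM A : measurable [set w | M w = A].
  have -> : [set w | M w = A] = \bigcap_(ij in [set: 'I_m * 'I_n])
      ((fun w => M w ij.1 ij.2) @^-1` [set A ij.1 ij.2]).
    apply/seteqP; split=> [w /= MA ij _ /=|w MA /=]; first by rewrite MA.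
    by apply/matrixP => i c; apply: (MA (i, c)).
  apply: fin_bigcap_measurable => // ij _.
  by case: M_balanced => + _ _; apply.
(* The rank never exceeds [m], so the truncated subtraction loses nothing. *)
rewrite (_ : [set w | _] = [set w | (m - \rank (M w))%N == k]); last first.
  apply/seteqP; split=> w /= => [rk|/eqP <-].
    by rewrite -(addKn (\rank (M w)) k) rk.
  by rewrite subnKC // rank_leq_row.
rewrite (@finite_rv_prob _ _ _ P _ M mM (fun A => (m - \rank A)%N == k)).
under eq_bigr => A _ do rewrite matrix_law.
rewrite sumEFin big_mkcond; congr EFin; apply: eq_bigr => A _.
by case: ifP; rewrite ?mul1r ?mul0r.
Qed.

End RandomMatrixLaw.

(** Even [m] bounds [a n] from above and odd [m] from below; two consecutive large values of [m] are
    fixed before [n] tends to infinity. *)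
Lemma cvg_alternating_bounds (R : realType) (a : nat -> R) (E : nat -> nat -> R)
    (l : nat -> R) (c : R) :
  (forall m n, 0 <= (-1) ^+ m * (E m n - a n)) ->
  (forall m, E m n @[n --> \oo] --> l m) -> l m @[m --> \oo] --> c ->
  a n @[n --> \oo] --> c.
Proof.
move=> alt El lc; apply/cvgrPdist_lt => e e0.
have e2 : 0 < e / 2 by rewrite divr_gt0.
move/cvgrPdist_lt : lc => /(_ _ e2) [m _ lm].
have dm i : (m <= i)%N -> \forall n \near \oo, `|c - E i n| < e.
  move=> mi; move/cvgrPdist_lt : (El i) => /(_ _ e2); apply: filterS => n.
  have -> : c - E i n = (c - l i) + (l i - E i n) by rewrite addrA subrK.
  by move=> ln; rewrite (le_lt_trans (ler_normD _ _)) // [e]splitr ltrD // lm.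
apply: filterS2 (dm m.*2 _) (dm m.*2.+1 _) => [n||]; last 2 first.
- by rewrite -addnn leq_addr.
- by rewrite -addnn -addnS leq_addr.
have := alt m.*2 n; have := alt m.*2.+1 n.
rewrite exprS -signr_odd odd_double expr0 mulr1 mulN1r mul1r.
by rewrite !ltr_norml => h1 h2 /andP[h3 h4] /andP[h5 h6]; apply/andP; split; lra.
Qed.

(** The event is written with addition so that it is empty for [k > n], where truncated subtraction
    would describe rank 0. *)
Theorem corollary3p5 (R : realType) (p : nat) (p_prime : prime p)
    (eps : R) (eps_gt0 : 0 < eps) (u : nat)
    (d : nat -> measure_display) (T : forall n : nat, measurableType (d n))
    (P : forall n : nat, probability (T n) R)
    (M : forall n : nat, T n -> 'M['F_p]_(n, n + u))
    (M_balanced : forall n : nat, eps_balanced (P n) eps (M n))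
    (k : nat) :
  P n [set w | (\rank (M n w) + k)%N = n] @[n --> \oo] -->
    (p%:R ^- (k * (k + u))
      * (\prod_(1 <= i < k.+1) (1 - p%:R ^- i)^-1)
      * (\prod_(1 <= i < (k + u).+1) (1 - p%:R ^- i)^-1)
      * infinite_prod (fun i : nat => 1 - p%:R ^- i))%:E.
Proof.
pose q : R := p%:R.
have q2 : 2 <= q by rewrite ler_nat prime_gt1.
have q1 : 1 < q by lra.
have q0 : q != 0 by rewrite gt_eqF //; lra.
pose mu n := entry_law (P n) (M n).
have mu_bal n i c : balanced_law eps (mu n i c) by exact: entry_law_balanced.
rewrite (_ : (fun n => _) =
  (fun n => (\sum_A ((n - \rank A)%N == k)%:R * matrix_mass (mu n) A)%:E)); last first.
  by apply/funext => n; rewrite (prob_corank (M_balanced n)).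
apply: cvg_EFin; first by apply: nearW.
(* The expectation of the Lagrange polynomial at p^corank; [l m] is its limit in [n], read off from
   the limiting moments. *)
pose E m n := \sum_A lagrange_basis q k m (q ^+ (n - \rank A)) * matrix_mass (mu n) A.
pose l m := \sum_(i < m.+1) newton_coef q k i * q ^- ((k + i) * u).
apply: (@cvg_alternating_bounds _ _ E l) => [m n|m|].
- rewrite /E -sumrB mulr_sumr sumr_ge0 // => A _.
  rewrite -mulrBl mulrA mulr_ge0 ?lagrange_basis_alternating //.
  by apply: prodr_ge0 => c _; apply: prodr_ge0 => i _; case: (mu_bal n i c).
(* In the Newton basis [E m n] is a finite combination, with coefficients free of [n], of moments
   whose limits are known. *)
- rewrite (_ : E m = fun n => \sum_(i < m.+1) newton_coef q k i *
    \sum_A newton_basis q (k + i) (q ^+ (n - \rank A)) * matrix_mass (mu n) A).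
    apply: cvg_big => [|i _]; first exact: add_continuous.
    apply: cvgMl_tmp.
    exact: (corank_moment_cvg p_prime eps_gt0 mu_bal).
  apply/funext => n; rewrite /E.
  under [RHS]eq_bigr => i _ do rewrite mulr_sumr.
  rewrite exchange_big; apply: eq_bigr => A _.
  rewrite lagrange_basis_newton // mulr_suml; apply: eq_bigr => i _.
  by rewrite mulrA.
rewrite (_ : l = fun m => q ^- (k * u) / newton_basis q k (q ^+ k) *
    series (euler_term q (k + u)) m.+1); last first.
  by apply/funext => m; rewrite /l newton_limit_series.
(* The factor [newton_basis q k (q ^+ k)] accounts for q^(k k) and the product up to [k]; Euler's
   series supplies the other two products. *)
have -> : p%:R ^- (k * (k + u)) * \prod_(1 <= i < k.+1) (1 - p%:R ^- i)^-1 =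
    q ^- (k * u) / newton_basis q k (q ^+ k).
  rewrite newton_basis_node // invfM mulrA -invfM -exprD prodfV.
  by rewrite mulnDr addnC.
rewrite -mulrA -euler_sum_eq //; apply: cvgMl_tmp.
rewrite (cvg_shiftS (series (euler_term q (k + u)))).
exact: is_cvg_series_euler.
Qed.
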